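(* Suppose that $\mathcal{H}_K$ is a contractive analytic Hilbert space on $\mathbb{B}^n$ such that the monomials $z^{k}$ $(k\in\mathbb{N}^n)$ form an orthogonal basis of $\mathcal{H}_K$. Let $p\in\mathbb{C}[z_1,\ldots,z_n]$ be a quasi-homogeneous polynomial. Then $$\|p\|_{\mathcal{H}_K} = \|p\|_{\mathcal{M}(H^2_n,\mathcal{H}_K)} .$$ If $\|p\|_{\mathcal{H}_K}=1$, then $p$ is a $K$-inner function.
   Context: $\mathbb{N}$ contains $0$; $\mathbb{B}^n$ is the open unit ball of $\mathbb{C}^n$. Let $K : \mathbb{B}^n\times\mathbb{B}^n\to\mathbb{C}$ be a positive definite function (i.e. a positive semidefinite kernel) and $\mathcal{H}_K$ the (complex) reproducing kernel Hilbert space with kernel $K$. $\mathcal{H}_K$ is a contractive analytic Hilbert space on $\mathbb{B}^n$ if it consists of analytic functions on $\mathbb{B}^n$ and the tuple $M_z=(M_{z_1},\ldots,M_{z_n})$ of multiplications by the coordinate functions is a (well-defined, bounded) pure row contraction on $\mathcal{H}_K$. Here a commuting tuple $T=(T_1,\dots,T_n)$ of bounded operators is a row contraction if $P_T(I)\le I$, where $P_T(X)=\sum_{i=1}^n T_iXT_i^*$, and it is pure if $P_T^m(I)\to 0$ strongly as $m\to\infty$. $H^2_n$ is the Drury-Arveson space, the reproducing kernel Hilbert space on $\mathbb{B}^n$ with kernel $(1-\sum_{i=1}^n z_i\bar w_i)^{-1}$. $\mathcal{M}(H^2_n,\mathcal{H}_K)$ is the set of functions $\theta:\mathbb{B}^n\to\mathbb{C}$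 with $\theta f\in\mathcal{H}_K$ for every $f\in H^2_n$; the multiplication operator $M_\theta:H^2_n\to\mathcal{H}_K$, $f\mapsto\theta f$, is then bounded, and $\|\theta\|_{\mathcal{M}(H^2_n,\mathcal{H}_K)}$ denotes its operator norm. A (scalar) function $\theta:\mathbb{B}^n\to\mathbb{C}$ is $K$-inner if $\theta\in\mathcal{H}_K$, $\|\theta\|_{\mathcal{H}_K}=1$ and $\theta\perp z^{k}\theta$ in $\mathcal{H}_K$ for all $k\in\mathbb{N}^n\setminus\{0\}$. A polynomial $p=\sum_{k\in\mathbb{N}^n}a_kz^k$ is quasi-homogeneous if there are a tuple $(m_1,\ldots,m_n)$ of positive integers and an integer $\ell\ge 0$ such that $\sum_{i=1}^n m_ik_i=\ell$ for all $k\in\mathbb{N}^n$ with $a_k\ne 0$. *)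

(* Defs.v *)
From HB Require Import structures.
From mathcomp Require Import all_boot all_order all_algebra.
From mathcomp Require Import sesquilinear complex.
From mathcomp Require Import all_classical all_reals all_analysis.
From mathcomp Require Import -(notations) mpoly.
Set Implicit Arguments.
Unset Strict Implicit.
Unset Printing Implicit Defensive.
Import Order.TTheory GRing.Theory Num.Theory numFieldNormedType.Exports.
Local Open Scope classical_set_scope.
Local Open Scope ring_scope.
Local Open Scope complex_scope.

(* The form is linear in its first and conjugate-linear in its second
   argument. *)
Record hilbert (R : realType) := Hilbert {
  hilbert_sort :> completeNormedModType R[i];
  hdot : {dot hilbert_sort for @Num.conj R[i]};
  hdotE : forall u : hilbert_sort, hdot u u = `|u| ^+ 2
}.

(* `|u| lives in R[i], where it is a nonnegative real. *)
Definition hnorm (R : realType) (H : hilbert R) (u : H) : R :=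
  complex.Re `|u|.

Section Operators.
Variable R : realType.
Implicit Types H : hilbert R.

(* Extended-real valued: +oo for an unbounded operator. *)
Definition op_norm H H' (T : H -> H') : \bar R :=
  ereal_sup [set (hnorm (T u))%:E | u in [set u : H | hnorm u <= 1]].

Definition bounded_operator H H' (T : H -> H') : Prop :=
  linear T /\ (op_norm T < +oo)%E.

(* For a bounded operator T the vector w exists and is unique, by Riesz. *)
Definition adjoint H (T : H -> H) : H -> H :=
  fun v => xget 0 [set w : H | forall u : H, hdot H (T u) v = hdot H u w].

(* P_T(X) = \sum_i T_i X T_i^* *)
Definition cp_map H n (T : 'I_n -> H -> H) (X : H -> H) : H -> H :=
  fun v => \sum_(i < n) T i (X (adjoint (T i) v)).

Definition row_contraction H n (T : 'I_n -> H -> H) : Prop :=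
  [/\ forall i, bounded_operator (T i),
      forall i j v, T i (T j v) = T j (T i v)
    & forall v : H, hdot H (cp_map T id v) v <= hdot H v v].

Definition pure H n (T : 'I_n -> H -> H) : Prop :=
  forall v : H, (fun m : nat => iter m (cp_map T) id v) @ \oo --> (0 : H).

Definition lin_span H (I : Type) (e : I -> H) : set H :=
  [set u | exists (s : seq I) (c : I -> R[i]), u = \sum_(i <- s) c i *: e i].

Definition orthogonal_basis H (I : Type) (e : I -> H) : Prop :=
  [/\ forall i, e i != 0,
      forall i j, i <> j -> hdot H (e i) (e j) = 0
    & closure (lin_span e) = setT].

End Operators.

Section ReproducingKernels.
Variables (R : realType) (X : Type).

Definition positive_definite (K : X -> X -> R[i]) : Prop :=
  forall (m : nat) (x : 'I_m -> X) (c : 'I_m -> R[i]),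
    0 <= \sum_(i < m) \sum_(j < m) c i * Num.conj (c j) * K (x i) (x j).

(* The reproducing kernel Hilbert space of K: a Hilbert space identified with
   a space of functions on X through the injective map rkhs_fun, which is
   linear by the reproducing property.  It is determined by K up to an
   isometric isomorphism compatible with rkhs_fun. *)
Record rkhs (K : X -> X -> R[i]) := Rkhs {
  rkhs_space :> hilbert R;
  rkhs_fun : rkhs_space -> X -> R[i];
  rkhs_fun_inj : injective rkhs_fun;
  rkhs_ker : X -> rkhs_space;
  rkhs_kerE : forall z w, rkhs_fun (rkhs_ker w) z = K z w;
  rkhs_reproducing :
    forall f w, rkhs_fun f w = hdot rkhs_space f (rkhs_ker w)
}.

Variables (K L : X -> X -> R[i]) (H : rkhs K) (H' : rkhs L).

Definition multiplier (theta : X -> R[i]) : Prop :=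
  forall f : H, exists g : H',
    rkhs_fun g = (fun z => theta z * rkhs_fun f z).

(* Meaningful when theta is a multiplier from H to H'. *)
Definition mult_op (theta : X -> R[i]) : H -> H' :=
  fun f => xget 0 [set g : H' | rkhs_fun g = (fun z => theta z * rkhs_fun f z)].

Definition multiplier_norm (theta : X -> R[i]) : \bar R :=
  op_norm (mult_op theta).

End ReproducingKernels.

Arguments mult_op {R X K L} H H' theta.
Arguments multiplier {R X K L} H H' theta.
Arguments multiplier_norm {R X K L} H H' theta.

Section UnitBall.
Variables (R : realType) (n : nat).

Definition unit_ball := {z : 'rV[R[i]]_n | \sum_(i < n) `|z 0 i| ^+ 2 < 1}.

Definition coord_fun (i : 'I_n) (z : unit_ball) : R[i] := val z 0 i.

Definition monom_fun (k : multinom n) (z : unit_ball) : R[i] :=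
  \prod_(i < n) (coord_fun i z) ^+ (k i).

Definition poly_fun (p : mpoly n R[i]) (z : unit_ball) : R[i] :=
  meval (fun i => coord_fun i z) p.

(* 'rV[R[i]]_n with its normed space structure over R[i] made explicit. *)
Definition Cn : normedModType R[i] := 'rV[R[i]]_n.

(* Differentiability is over the field R[i], that is, complex
   differentiability; the ball being open, the values of g off the ball do not
   matter. *)
Definition analytic (f : unit_ball -> R[i]) : Prop :=
  exists g : Cn -> R[i]^o,
    (forall z : unit_ball, g (val z) = f z) /\
    (forall z : unit_ball, differentiable g (val z : Cn)).

Definition drury_arveson (z w : unit_ball) : R[i] :=
  (1 - \sum_(i < n) coord_fun i z * Num.conj (coord_fun i w))^-1.

Definition Mz (K : unit_ball -> unit_ball -> R[i]) (H : rkhs K) (i : 'I_n) :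
  H -> H := mult_op H H (coord_fun i).

Definition contractive_analytic (K : unit_ball -> unit_ball -> R[i])
    (H : rkhs K) : Prop :=
  [/\ forall f : H, analytic (rkhs_fun f),
      forall i, multiplier H H (coord_fun i),
      row_contraction (Mz (H := H))
    & pure (Mz (H := H))].

Definition monomial_orthogonal_basis (K : unit_ball -> unit_ball -> R[i])
    (H : rkhs K) : Prop :=
  exists e : multinom n -> H,
    (forall k, rkhs_fun (e k) = monom_fun k) /\ orthogonal_basis e.

Definition K_inner (K : unit_ball -> unit_ball -> R[i]) (H : rkhs K)
    (theta : unit_ball -> R[i]) : Prop :=
  exists f : H,
    [/\ rkhs_fun f = theta, hnorm f = 1
      & forall k : multinom n, k != mnm0 -> exists g : H,
          rkhs_fun g = (fun z => monom_fun k z * theta z) /\ hdot H f g = 0].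

Definition quasi_homogeneous (p : mpoly n R[i]) : Prop :=
  exists (m : 'I_n -> nat) (l : nat), (forall i, (0 < m i)%N) /\
    (forall k : multinom n, mcoeff k p != 0 -> (\sum_(i < n) m i * k i = l)%N).

End UnitBall.

(* Main.v *)
(** A polynomial [p] that is homogeneous for positive weights [m] is orthogonal
    in the space of [K] to [z_i q p] for every polynomial [q], because monomials of
    different weight are orthogonal.  Write a polynomial as a sum over words,
    [q = c + \sum_i z_i q_i].  By this orthogonality and the row contraction
    property, [|q p|^2 = |c|^2 |p|^2 + |\sum_i z_i q_i p|^2
    <= |c|^2 |p|^2 + \sum_i |q_i p|^2], so by induction [|q p| <= |q| |p|], where
    [|q|] is the l^2 norm of the coefficients over words.  When [q] is a
    truncation of the expansion of [\sum_j a_j k_(w_j)], with [k] the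
    Drury-Arveson kernel, the coefficient of [z_(i_1) ... z_(i_d)] is
    [\sum_j a_j conj(w_(j,i_1)) ... conj(w_(j,i_d))] and [|q|] tends to the norm of
    that sum of kernels.  Hence [p] is a multiplier of norm at most [|p|]; the
    constant function 1, which is the kernel at 0, attains the bound. *)
Require Import Defs.
From mathcomp Require Import all_boot all_order all_algebra.
From mathcomp Require Import sesquilinear complex ring lra.
From mathcomp Require Import all_classical all_reals all_analysis.
From mathcomp Require Import -(notations) mpoly.
Set Implicit Arguments.
Unset Strict Implicit.
Unset Printing Implicit Defensive.
Import Order.TTheory GRing.Theory Num.Theory numFieldNormedType.Exports.
Import Normc.
Local Open Scope classical_set_scope.
Local Open Scope ring_scope.
Local Open Scope complex_scope.

Section InnerProduct.
Variables (R : realType) (H : hilbert R).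
Implicit Types u v w : H.
Local Notation dot := (hdot H).

Lemma normrE_hnorm u : `|u| = (hnorm u)%:C.
Proof. by rewrite /hnorm RRe_real ?normr_real. Qed.

Lemma hdot_hnorm u : dot u u = (hnorm u ^+ 2)%:C.
Proof. by rewrite hdotE normrE_hnorm rmorphXn. Qed.

Lemma hnorm_ge0 u : 0 <= hnorm u.
Proof. by rewrite -ler0c -normrE_hnorm normr_ge0. Qed.

Lemma hnormD u v : hnorm (u + v) <= hnorm u + hnorm v.
Proof. by rewrite -lecR rmorphD /= -!normrE_hnorm ler_normD. Qed.

Lemma hnorm0 : hnorm (0 : H) = 0.
Proof. by apply: complexI; rewrite -normrE_hnorm normr0. Qed.

Lemma hnormZ (a : R[i]) u : hnorm (a *: u) = normc a * hnorm u.
Proof. by apply: complexI; rewrite rmorphM /= -!normrE_hnorm normrZ; case: a. Qed.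

Lemma hnormN u : hnorm (- u) = hnorm u.
Proof. by rewrite /hnorm normrN. Qed.

Lemma hnorm_eq0 u : hnorm u = 0 -> u = 0.
Proof. by move=> u0; apply/eqP; rewrite -normr_eq0 normrE_hnorm u0. Qed.

Lemma hdotDl u v w : dot (u + v) w = dot u w + dot v w.
Proof. exact: linearDl. Qed.
Lemma hdotDr u v w : dot u (v + w) = dot u v + dot u w.
Proof. exact: linearDr. Qed.
Lemma hdotBl u v w : dot (u - v) w = dot u w - dot v w.
Proof. exact: linearBl. Qed.
Lemma hdotBr u v w : dot u (v - w) = dot u v - dot u w.
Proof. exact: linearBr. Qed.
Lemma hdotZl (a : R[i]) u v : dot (a *: u) v = a * dot u v.
Proof. exact: linearZl_LR. Qed.
Lemma hdotZr (a : R[i]) u v : dot u (a *: v) = Num.conj a * dot u v.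
Proof. exact: linearZr_LR. Qed.
Lemma hdot0l u : dot 0 u = 0.
Proof. exact: linear0l. Qed.
Lemma hdot0r u : dot u 0 = 0.
Proof. exact: linear0r. Qed.
Lemma hdotC u v : dot u v = Num.conj (dot v u).
Proof. by rewrite hermC expr0 mul1r. Qed.
Lemma hdot_suml (I : Type) (s : seq I) (F : I -> H) v :
  dot (\sum_(i <- s) F i) v = \sum_(i <- s) dot (F i) v.
Proof. exact: linear_sumlz. Qed.
Lemma hdot_sumr (I : Type) (s : seq I) (F : I -> H) v :
  dot v (\sum_(i <- s) F i) = \sum_(i <- s) dot v (F i).
Proof. exact: linear_sumr. Qed.

Lemma hnorm_sqrE u : hnorm u ^+ 2 = complex.Re (dot u u).
Proof. by rewrite hdot_hnorm. Qed.

Lemma normcE_norm (z : R[i]) : `|z| = (normc z)%:C.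
Proof. by case: z. Qed.

Lemma normc_ge0 (z : R[i]) : 0 <= normc z.
Proof. by rewrite -ler0c -normcE_norm normr_ge0. Qed.

Lemma normc_hdot u v : normc (dot u v) <= hnorm u * hnorm v.
Proof.
have [v0|v_neq0] := eqVneq (hnorm v) 0.
  by rewrite (hnorm_eq0 v0) hdot0r normc0 hnorm0 mulr0.
have v_gt0 : 0 < hnorm v by rewrite lt_def v_neq0 hnorm_ge0.
have vv_neq0 : dot v v != 0.
  by rewrite hdot_hnorm -(rmorph0 (real_complex R)) (inj_eq (@complexI _)) sqrf_eq0.
pose a := dot u v / dot v v; pose w := u - a *: v.
have wv : dot w v = 0 by rewrite hdotBl hdotZl divfK ?subrr.
have : 0 <= dot w w * dot v v.
  by rewrite !hdot_hnorm -rmorphM ler0c mulr_ge0 ?sqr_ge0.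
rewrite {2}/w hdotBr hdotZr wv mulr0 subr0 hdotBl hdotZl mulrBl mulrAC divfK //.
rewrite [dot v u]hdotC -normCK normcE_norm !hdot_hnorm -!rmorphM -rmorphXn -rmorphB.
rewrite ler0c subr_ge0 -exprMn ler_sqr ?nnegrE ?mulr_ge0 ?hnorm_ge0 ?normc_ge0//.
Qed.

Lemma hnorm_sqrD u v : dot u v = 0 ->
  hnorm (u + v) ^+ 2 = hnorm u ^+ 2 + hnorm v ^+ 2.
Proof.
move=> uv; rewrite !hnorm_sqrE !hdotDl !hdotDr uv [dot v u]hdotC uv rmorph0.
by rewrite addr0 add0r raddfD.
Qed.

Lemma parallelogram u v :
  hnorm (u + v) ^+ 2 + hnorm (u - v) ^+ 2 = 2 * (hnorm u ^+ 2 + hnorm v ^+ 2).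
Proof.
rewrite !hnorm_sqrE !hdotDl !hdotDr !(linearNl, linearNr, opprK) !raddfD !raddfN /=.
by ring.
Qed.

End InnerProduct.

Section Completeness.
Variables (R : realType) (H : hilbert R).
Local Notation dot := (hdot H).

Lemma hilbert_cauchy (u : nat -> H) (e : nat -> R) :
  e @ \oo --> (0 : R) ->
  (forall m n, (m <= n)%N -> hnorm (u n - u m) <= e m) ->
  exists l : H, forall m, hnorm (l - u m) <= e m.
Proof.
move=> e0 u_cauchy.
have cvg_u : cvg (u @ \oo).
  apply/cauchy_cvgP/cauchy_exP => eps eps_gt0.
  have epsE : (complex.Re eps)%:C = eps by rewrite RRe_real ?gtr0_real.
  have r_gt0 : 0 < complex.Re eps by rewrite -ltcR epsE.
  have /cvgrPdist_lt/(_ _ r_gt0) [N _ eN] := e0.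
  exists (u N); exists N => // n /= Nn.
  rewrite -ball_normE /= distrC normrE_hnorm -epsE ltcR.
  rewrite (le_lt_trans (u_cauchy _ _ Nn)) //.
  by have := eN N (leqnn N); rewrite /= sub0r normrN; exact/le_lt_trans/ler_norm.
exists (lim (u @ \oo)) => m; apply/ler_addgt0Pr => r r_gt0.
have rC : 0 < r%:C by rewrite ltcR.
have /cvgrPdist_lt/(_ _ rC) [N _ uN] : u @ \oo --> lim (u @ \oo) := cvg_u.
have := uN _ (leq_maxl N m); rewrite /= normrE_hnorm ltcR => /ltW lN.
have -> : lim (u @ \oo) - u m =
  (lim (u @ \oo) - u (maxn N m)) + (u (maxn N m) - u m) by rewrite addrA subrK.
by rewrite (le_trans (hnormD _ _)) // addrC lerD // u_cauchy ?leq_maxr.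
Qed.

Lemma le0_of_null (x : R) (e : nat -> R) : e @ \oo --> (0 : R) ->
  (forall m, x <= e m) -> x <= 0.
Proof.
move=> e0 xe; rewrite -(cvg_lim (@Rhausdorff R) e0); apply: limr_ge => //.
  by apply: cvgP e0.
by apply: nearW.
Qed.

Lemma eq0_of_null (z : R[i]) (e : nat -> R) : e @ \oo --> (0 : R) ->
  (forall m, normc z <= e m) -> z = 0.
Proof.
move=> e0 ze; apply: eq0_normc; apply/le_anti.
by rewrite normc_ge0 (le0_of_null e0).
Qed.

Lemma null_sqrt (e : nat -> R) : e @ \oo --> (0 : R) ->
  (fun m => Num.sqrt (e m)) @ \oo --> (0 : R).
Proof.
move=> e0; rewrite -(sqrtr0 R).
by apply: continuous_cvg => //; exact: sqrt_continuous.
Qed.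

Lemma nullZ (c : R) (e : nat -> R) : e @ \oo --> (0 : R) ->
  (fun m => c * e m) @ \oo --> (0 : R).
Proof. by move=> e0; rewrite -(mulr0 c); apply: cvgM => //; exact: cvg_cst. Qed.

Definition subspace (M : set H) : Prop :=
  [/\ M 0, forall u v, M u -> M v -> M (u + v) &
      forall (a : R[i]) u, M u -> M (a *: u)].

Lemma projection (M : set H) (f : H) : subspace M ->
  exists v : H, (forall m, exists2 u, M u & hnorm (v - u) <= 2 * m.+1%:R^-1) /\
    forall u, M u -> dot (f - v) u = 0.
Proof.
case=> M0 MD MZ.
pose D := [set hnorm (f - u) ^+ 2 | u in M].
have D_inf : has_inf D.
  split; first by exists (hnorm (f - 0) ^+ 2); exists 0.
  by exists 0 => _ [u _ <-]; exact: sqr_ge0.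
pose d := inf D; pose e m : R := m.+1%:R^-1.
have e_gt0 m : 0 < e m by rewrite invr_gt0.
have d_le u : M u -> d <= hnorm (f - u) ^+ 2.
  by move=> Mu; apply: inf_lbound; [case: D_inf|exists u].
have [u uP] : {u : nat -> H & forall m, M (u m) /\ hnorm (f - u m) ^+ 2 < d + e m ^+ 2}.
  apply: (@choice _ _ (fun m v => M v /\ hnorm (f - v) ^+ 2 < d + e m ^+ 2)) => m.
  have [_ [v Mv <-] vd] := inf_adherent (exprn_gt0 2 (e_gt0 m)) D_inf.
  by exists v.
have e_anti m n : (m <= n)%N -> e n <= e m by move=> mn; rewrite lef_pV2 ?posrE ?ler_nat.
have u_cauchy m n : (m <= n)%N -> hnorm (u n - u m) <= 2 * e m.
  move=> mn; rewrite -ler_sqr ?nnegrE ?hnorm_ge0 ?mulr_ge0 ?ltW//.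
  have [Mn un] := uP n; have [Mm um] := uP m.
  have := parallelogram (f - u m) (f - u n).
  have -> : f - u m + (f - u n) = 2 *: (f - 2^-1 *: (u m + u n)).
    rewrite scalerBr scalerA divff ?pnatr_eq0// scale1r scaler_nat mulr2n.
    by rewrite addrACA opprD.
  have -> : f - u m - (f - u n) = u n - u m.
    by rewrite opprB addrC addrA subrK.
  have := d_le _ (MZ 2^-1 _ (MD _ _ Mm Mn)).
  rewrite hnormZ (_ : normc 2 = 2); last first.
    by apply: complexI; rewrite -normcE_norm normr_nat rmorph_nat.
  have : e n ^+ 2 <= e m ^+ 2 by rewrite ler_sqr ?nnegrE ?e_anti // ltW.
  by rewrite !exprMn => H1 H2 H3; lra.
have e0 : e @ \oo --> (0 : R) by exact: cvg_harmonic.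
have [v vP] := hilbert_cauchy (nullZ 2 e0) u_cauchy.
exists v; split=> [m|w Mw]; first by exists (u m) => //; case: (uP m).
apply: (eq0_of_null (nullZ (3 * hnorm w) e0)) => m.
have [Mm um] := uP m.
have -> : dot (f - v) w = dot (f - u m) w - dot (v - u m) w.
  by rewrite -hdotBl opprB addrA subrK.
have near : normc (dot (f - u m) w) <= hnorm w * e m.
  have [w0|w_neq0] := eqVneq (hnorm w) 0.
    by rewrite (hnorm_eq0 w0) hdot0r normc0 hnorm0 mul0r.
  have w_gt0 : 0 < hnorm w by rewrite lt_def w_neq0 hnorm_ge0.
  have ww_neq0 : dot w w != 0.
    by rewrite hdot_hnorm -(rmorph0 (real_complex R)) (inj_eq (@complexI _)) sqrf_eq0.
  pose a := dot (f - u m) w / dot w w; pose y := f - u m - a *: w.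
  have yw : dot y w = 0 by rewrite hdotBl hdotZl divfK ?subrr.
  have yaw : dot y (a *: w) = 0 by rewrite hdotZr yw mulr0.
  have := hnorm_sqrD yaw; rewrite subrK hnormZ exprMn => E.
  have := d_le _ (MD _ _ Mm (MZ a _ Mw)); rewrite opprD addrA -/y => yd.
  have aw : normc a * hnorm w <= e m.
    rewrite -ler_sqr ?nnegrE ?mulr_ge0 ?hnorm_ge0 ?normc_ge0 ?ltW// exprMn.
    by move: um; rewrite E; lra.
  have -> : dot (f - u m) w = a * dot w w by rewrite divfK.
  rewrite normcM hdot_hnorm.
  have -> : normc (hnorm w ^+ 2)%:C = hnorm w ^+ 2.
    by apply: complexI; rewrite -normcE_norm ger0_norm // ler0c sqr_ge0.
  by rewrite expr2 mulrA mulrC ler_pM2l.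
have far : normc (dot (v - u m) w) <= 2 * e m * hnorm w.
  by rewrite (le_trans (normc_hdot _ _)) // ler_wpM2r ?hnorm_ge0.
have tri : normc (dot (f - u m) w - dot (v - u m) w) <=
    normc (dot (f - u m) w) + normc (dot (v - u m) w).
  rewrite -lecR rmorphD /= -!normcE_norm; exact: ler_normB.
by apply: (le_trans tri); lra.
Qed.

End Completeness.

Section Operators.
Variables (R : realType) (H : hilbert R).
Local Notation dot := (hdot H).

Lemma riesz (phi : H -> R[i]) (c : R) : scalar phi -> 0 <= c ->
  (forall u, normc (phi u) <= c * hnorm u) ->
  exists w : H, forall u, phi u = dot u w.
Proof.
move=> phiP c_ge0 phi_le.
have phi0 : phi 0 = 0 by have := phiP (-1) 0 0; rewrite scaler0 addr0 mulN1r addNr.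
have phiZ a u : phi (a *: u) = a * phi u by rewrite -[a *: u]addr0 phiP phi0 addr0.
have phiD u v : phi (u + v) = phi u + phi v by rewrite -[u]scale1r phiP mul1r scale1r.
have phiB u v : phi (u - v) = phi u - phi v by rewrite phiD -scaleN1r phiZ mulN1r.
have [all0|] := pselect (forall u, phi u = 0).
  by exists 0 => u; rewrite all0 hdot0r.
move=> /existsNP[u0 /eqP u0_neq0].
have ker_sub : subspace [set u : H | phi u = 0].
  split=> //= [u v /= pu pv|a u /= pu]; first by rewrite phiD pu pv addr0.
  by rewrite phiZ pu mulr0.
have [v [v_lim v_orth]] := projection u0 ker_sub.
have phiv : phi v = 0.
  apply: (eq0_of_null (nullZ c (nullZ 2 (@cvg_harmonic R)))) => m /=.
  have [u /= pu vu] := v_lim m.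
  by rewrite -[phi v]subr0 -pu -phiB (le_trans (phi_le _)) // ler_wpM2l.
pose z := u0 - v.
have phiz : phi z = phi u0 by rewrite phiB phiv subr0.
have zz_neq0 : dot z z != 0.
  apply: contra u0_neq0 => /eqP; rewrite hdot_hnorm => /eqP.
  rewrite -(rmorph0 (real_complex R)) (inj_eq (@complexI _)) sqrf_eq0 => /eqP /hnorm_eq0 z0.
  by rewrite -phiz z0 phi0.
exists (Num.conj (phi z / dot z z) *: z) => u.
have : phi (phi u *: z - phi z *: u) = 0 by rewrite phiB !phiZ mulrC subrr.
move/v_orth; rewrite -/z hdotC => /eqP; rewrite conjC_eq0 hdotBl !hdotZl subr_eq0 => /eqP E.
by rewrite hdotZr conjCK mulrAC -E mulfK.
Qed.

Lemma bounded_operator_bound (H' : hilbert R) (T : H -> H') : bounded_operator T ->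
  exists2 c : R, 0 <= c & forall u, hnorm (T u) <= c * hnorm u.
Proof.
case=> T_lin T_fin.
have T0 : T 0 = 0 by have := T_lin (-1) 0 0; rewrite scaler0 addr0 scaleN1r addNr.
have TZ a u : T (a *: u) = a *: T u by rewrite -[a *: u]addr0 T_lin T0 addr0.
have le_op u : hnorm u <= 1 -> ((hnorm (T u))%:E <= op_norm T)%E.
  by move=> u1; apply: ereal_sup_ubound; exists u.
have op_ge0 : (0 <= op_norm T)%E.
  by have := le_op 0; rewrite T0 !hnorm0; apply; exact: ler01.
have op_num : op_norm T \is a fin_num by rewrite ge0_fin_numE.
exists (fine (op_norm T)); first exact: fine_ge0.
move=> u; have [u0|u_neq0] := eqVneq (hnorm u) 0.
  by rewrite (hnorm_eq0 u0) T0 !hnorm0 mulr0.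
have u_gt0 : 0 < hnorm u by rewrite lt_def u_neq0 hnorm_ge0.
have normc_inv : normc ((hnorm u)^-1)%:C = (hnorm u)^-1.
  by apply: complexI; rewrite -normcE_norm ger0_norm // ler0c invr_ge0 ltW.
have := le_op (((hnorm u)^-1)%:C *: u).
rewrite TZ !hnormZ normc_inv mulVf // lexx => /(_ isT).
by rewrite -(fineK op_num) lee_fin ler_pdivrMl // mulrC.
Qed.

Lemma adjointP (T : H -> H) : bounded_operator T ->
  forall u v, dot (T u) v = dot u (adjoint T v).
Proof.
move=> T_bnd u v; have [c c_ge0 Tc] := bounded_operator_bound T_bnd.
have T_lin := T_bnd.1.
have [w wP] : exists w, forall u, dot (T u) v = dot u w.
  apply: (@riesz (fun u => dot (T u) v) (c * hnorm v)).
  - by move=> a x y; rewrite T_lin hdotDl hdotZl.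
  - by rewrite mulr_ge0 ?hnorm_ge0.
  - move=> x; rewrite (le_trans (normc_hdot _ _)) // mulrAC.
    by rewrite ler_wpM2r ?hnorm_ge0.
rewrite /adjoint; case: xgetP => [_ -> wP'|none]; first exact: wP'.
by case: (none w).
Qed.

(* With [v = \sum_i T_i y_i], the bound [\sum_i |T_i^* v|^2 <= |v|^2] and
   [0 <= \sum_i |y_i - T_i^* v|^2 = \sum_i |y_i|^2 - 2 |v|^2 + \sum_i |T_i^* v|^2]. *)
Lemma row_contraction_sum n (T : 'I_n -> H -> H) (y : 'I_n -> H) :
  row_contraction T ->
  hnorm (\sum_(i < n) T i (y i)) ^+ 2 <= \sum_(i < n) hnorm (y i) ^+ 2.
Proof.
case=> T_bnd _ T_row; set v := \sum_(i < n) T i (y i).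
pose w i := adjoint (T i) v.
have vv : hnorm v ^+ 2 = \sum_(i < n) complex.Re (dot (y i) (w i)).
  rewrite hnorm_sqrE {1}/v hdot_suml raddf_sum; apply: eq_bigr => i _.
  by rewrite adjointP.
have ww : \sum_(i < n) hnorm (w i) ^+ 2 <= hnorm v ^+ 2.
  have := T_row v; rewrite hdot_hnorm /cp_map hdot_suml.
  under eq_bigr do rewrite adjointP // hdot_hnorm.
  by rewrite -rmorph_sum lecR.
have : 0 <= \sum_(i < n) hnorm (y i - w i) ^+ 2.
  by apply: sumr_ge0 => i _; exact: sqr_ge0.
have -> : \sum_(i < n) hnorm (y i - w i) ^+ 2 =
    \sum_(i < n) hnorm (y i) ^+ 2 - 2 * hnorm v ^+ 2 + \sum_(i < n) hnorm (w i) ^+ 2.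
  rewrite vv mulr_sumr -sumrB -big_split /=; apply: eq_bigr => i _.
  rewrite !hnorm_sqrE hdotBl !hdotBr [dot (w i) (y i)]hdotC.
  by case: (dot (y i) (w i)) => a b; rewrite !raddfB /=; ring.
by lra.
Qed.

End Operators.

Section Kernels.
Variables (R : realType) (X : Type) (K : X -> X -> R[i]) (H : rkhs K).

Lemma rkhs_funP (a : R[i]) (f g : H) z :
  rkhs_fun (a *: f + g) z = a * rkhs_fun f z + rkhs_fun g z.
Proof. by rewrite !rkhs_reproducing hdotDl hdotZl. Qed.

Lemma rkhs_funB (f g : H) z : rkhs_fun (f - g) z = rkhs_fun f z - rkhs_fun g z.
Proof. by rewrite !rkhs_reproducing hdotBl. Qed.

Lemma rkhs_funZ (a : R[i]) (f : H) z : rkhs_fun (a *: f) z = a * rkhs_fun f z.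
Proof. by rewrite !rkhs_reproducing hdotZl. Qed.

Lemma rkhs_fun0 z : rkhs_fun (0 : H) z = 0.
Proof. by rewrite rkhs_reproducing hdot0l. Qed.

Lemma rkhs_fun_sum (I : Type) (s : seq I) (F : I -> H) z :
  rkhs_fun (\sum_(i <- s) F i) z = \sum_(i <- s) rkhs_fun (F i) z.
Proof.
rewrite rkhs_reproducing hdot_suml; apply: eq_bigr => i _.
by rewrite rkhs_reproducing.
Qed.

Lemma rkhs_fun_bound (f : H) z : normc (rkhs_fun f z) <= hnorm f * hnorm (rkhs_ker H z).
Proof. by rewrite rkhs_reproducing normc_hdot. Qed.

Definition kernel_sum (s : seq (R[i] * X)) : H := \sum_(q <- s) q.1 *: rkhs_ker H q.2.

Lemma kernel_sum_dense (f : H) (m : nat) :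
  exists s, hnorm (f - kernel_sum s) <= 2 * m.+1%:R^-1.
Proof.
have sub : subspace [set u : H | exists s, u = kernel_sum s].
  split=> [|_ _ [s ->] [t ->]|a _ [s ->]] /=.
  - by exists [::]; rewrite /kernel_sum big_nil.
  - by exists (s ++ t); rewrite /kernel_sum big_cat.
  - exists [seq (a * q.1, q.2) | q <- s]; rewrite /kernel_sum big_map scaler_sumr.
    by apply: eq_bigr => q _; rewrite scalerA.
have [v [v_lim v_orth]] := projection f sub.
suff -> : f = v by have [_ [s ->] vs] := v_lim m; exists s.
apply: rkhs_fun_inj; apply: funext => z; apply/eqP; rewrite -subr_eq0 -rkhs_funB.
rewrite rkhs_reproducing v_orth //=; exists [:: (1, z)].
by rewrite /kernel_sum big_seq1 scale1r.
Qed.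

End Kernels.

Section GeometricSums.
Variable R : realType.
Implicit Types (t : R[i]) (l : seq (R[i] * R[i])) (N : nat).

Definition geo N t : R[i] := \sum_(k < N) t ^+ k.

Lemma geoS N t : geo N.+1 t = 1 + t * geo N t.
Proof.
rewrite /geo big_ord_recl expr0 mulr_sumr; congr (_ + _).
by apply: eq_bigr => i _; rewrite exprS.
Qed.

Lemma geo_tail N t : t != 1 -> (1 - t)^-1 - geo N t = t ^+ N / (1 - t).
Proof.
move=> t1; have nz : 1 - t != 0 by rewrite subr_eq0 eq_sym.
apply: (mulIf nz); rewrite mulrBl mulVf // divfK //.
have -> : t ^+ N = 1 + (t - 1) * geo N t by rewrite -subrX1 addrC subrK.
by ring.
Qed.

Definition geo_sum N l : R[i] := \sum_(c <- l) c.1 * geo N c.2.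
Definition geo_lim l : R[i] := \sum_(c <- l) c.1 * (1 - c.2)^-1.
Definition geo_err l N : R :=
  \sum_(c <- l) normc c.1 * (normc c.2 ^+ N / normc (1 - c.2)).

Lemma normc_sum (I : eqType) (s : seq I) (F : I -> R[i]) (G : I -> R) :
  {in s, forall i, normc (F i) <= G i} ->
  normc (\sum_(i <- s) F i) <= \sum_(i <- s) G i.
Proof.
move=> FG; rewrite -lecR -normcE_norm (le_trans (ler_norm_sum _ _ _)) //.
rewrite rmorph_sum /= big_seq [leRHS]big_seq ler_sum // => i /FG.
by rewrite normcE_norm lecR.
Qed.

Lemma normcB_le (z w : R[i]) : normc (z - w) <= normc z + normc w.
Proof. by rewrite -lecR rmorphD /= -!normcE_norm; exact: ler_normB. Qed.

Lemma normcX N t : normc (t ^+ N) = normc t ^+ N.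
Proof. by elim: N => [|N IH]; rewrite ?expr0 ?normc1 // !exprS normcM IH. Qed.

Lemma normcJ (z : R[i]) : normc (Num.conj z) = normc z.
Proof. by apply: complexI; rewrite -!normcE_norm norm_conjC. Qed.

Definition subunit l := all (fun c => normc c.2 < 1) l.

Lemma subunit_neq1 t : normc t < 1 -> t != 1.
Proof. by apply: contraTneq => ->; rewrite normc1 ltxx. Qed.

Lemma geo_errP l N : subunit l -> normc (geo_lim l - geo_sum N l) <= geo_err l N.
Proof.
move=> /allP l1; rewrite -sumrB; apply: normc_sum => c /l1 c1.
by rewrite -mulrBr geo_tail ?subunit_neq1 // !normcM normcX normcV.
Qed.

Lemma geo_err_ge0 l N : 0 <= geo_err l N.
Proof.
by apply: sumr_ge0 => c _; rewrite mulr_ge0 ?divr_ge0 ?exprn_ge0 ?normc_ge0.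
Qed.

Lemma geo_err_anti l m N : subunit l -> (m <= N)%N -> geo_err l N <= geo_err l m.
Proof.
move=> /allP l1 mN; rewrite /geo_err big_seq [leRHS]big_seq ler_sum // => c /l1 c1.
rewrite ler_wpM2l ?normc_ge0 // ler_wpM2r ?invr_ge0 ?normc_ge0 //.
by rewrite ler_wiXn2l ?normc_ge0 // ltW.
Qed.

Lemma geo_err_null l : subunit l -> geo_err l @ \oo --> (0 : R).
Proof.
rewrite /geo_err; elim: l => [|c l IH] /=.
  by move=> _; under eq_fun do rewrite big_nil; exact: cvg_cst.
case/andP=> c1 l1; under eq_fun do rewrite big_cons.
suff c0 : (fun N => normc c.1 * (normc c.2 ^+ N / normc (1 - c.2))) @ \oo --> (0 : R).
  by have := cvgD c0 (IH l1); rewrite addr0; apply.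
apply: nullZ; rewrite -(mul0r (normc (1 - c.2))^-1); apply: cvgM; last exact: cvg_cst.
by apply: cvg_expr; rewrite ger0_norm ?normc_ge0.
Qed.

End GeometricSums.

Section BallProduct.
Variables (R : realType) (n : nat).
Local Notation ball := (unit_ball R n).

Definition ball_dot (z w : ball) : R[i] :=
  \sum_(i < n) coord_fun i z * Num.conj (coord_fun i w).

Lemma ball_dot_lt1 (z w : ball) : normc (ball_dot z w) < 1.
Proof.
have norm2 (v : ball) : \sum_(i < n) normc (coord_fun i v) ^+ 2 < 1.
  have := valP v; rewrite /= -ltcR rmorph_sum /=.
  by under eq_bigr do rewrite normcE_norm -rmorphXn.
apply: (@le_lt_trans _ _ (\sum_(i < n)
  (normc (coord_fun i z) ^+ 2 + normc (coord_fun i w) ^+ 2) / 2)).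
  apply: normc_sum => i _; rewrite normcM normcJ.
  have := sqr_ge0 (normc (coord_fun i z) - normc (coord_fun i w)).
  by rewrite sqrrB; lra.
rewrite -mulr_suml big_split /=; have := norm2 z; have := norm2 w; lra.
Qed.

(* On the word coefficients of the header, deletes the first letter [i]. *)
Definition shift_coef (i : 'I_n) (s : seq (R[i] * ball)) :=
  [seq (q.1 * Num.conj (coord_fun i q.2), q.2) | q <- s].

Definition gram (s : seq (R[i] * ball)) : seq (R[i] * R[i]) :=
  [seq (q.1 * Num.conj r.1, ball_dot r.2 q.2) | q <- s, r <- s].

Definition eval_list (s : seq (R[i] * ball)) (z : ball) : seq (R[i] * R[i]) :=
  [seq (q.1, ball_dot z q.2) | q <- s].

Lemma gram_subunit s : subunit (gram s).
Proof. by apply/allP => _ /allpairsP[[q r] /= [_ _ ->]]; exact: ball_dot_lt1. Qed.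

Lemma eval_list_subunit s z : subunit (eval_list s z).
Proof. by apply/allP => _ /mapP[q _ ->]; exact: ball_dot_lt1. Qed.

Lemma gram_lim (H : rkhs (@drury_arveson R n)) s :
  geo_lim (gram s) = (hnorm (kernel_sum H s) ^+ 2)%:C.
Proof.
rewrite -hdot_hnorm {1}/kernel_sum hdot_suml /geo_lim big_allpairs_dep /=.
apply: eq_bigr => q _; rewrite hdotZl /kernel_sum hdot_sumr mulr_sumr.
apply: eq_bigr => r _; rewrite hdotZr -rkhs_reproducing rkhs_kerE /=.
by rewrite mulrA.
Qed.

Lemma eval_list_lim (H : rkhs (@drury_arveson R n)) s z :
  geo_lim (eval_list s z) = rkhs_fun (kernel_sum H s) z.
Proof.
rewrite rkhs_fun_sum /geo_lim big_map; apply: eq_bigr => q _.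
by rewrite rkhs_funZ rkhs_kerE.
Qed.

Lemma gram_sumS N s : complex.Re (geo_sum N.+1 (gram s)) =
  normc (\sum_(q <- s) q.1) ^+ 2 +
  \sum_(i < n) complex.Re (geo_sum N (gram (shift_coef i s))).
Proof.
rewrite -raddf_sum /= -[normc _ ^+ 2]/(complex.Re (normc _ ^+ 2)%:C) -raddfD /=.
congr complex.Re; rewrite rmorphXn /= -normcE_norm normCK rmorph_sum /=.
rewrite /geo_sum; under [X in _ = _ + X]eq_bigr do rewrite /gram big_allpairs_dep big_map /=.
rewrite big_allpairs_dep [X in _ = _ + X]exchange_big /= mulr_suml -big_split /=.
apply: eq_bigr => q _; under [X in _ = _ + X]eq_bigr do rewrite big_map /=.
rewrite [X in _ = _ + X]exchange_big mulr_sumr -big_split /=; apply: eq_bigr => r _.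
rewrite geoS mulrDr mulr1; congr (_ + _).
rewrite /ball_dot mulr_suml mulr_sumr; apply: eq_bigr => i _.
by rewrite [Num.conj (r.1 * _)]rmorphM /= conjCK; ring.
Qed.

Lemma eval_sumS N s z : geo_sum N.+1 (eval_list s z) =
  \sum_(q <- s) q.1 + \sum_(i < n) coord_fun i z * geo_sum N (eval_list (shift_coef i s) z).
Proof.
rewrite /geo_sum /eval_list /shift_coef big_map.
under [X in _ = _ + X]eq_bigr do rewrite !big_map mulr_sumr /=.
rewrite [X in _ = _ + X]exchange_big -big_split /=; apply: eq_bigr => q _.
rewrite geoS mulrDr mulr1; congr (_ + _).
rewrite /ball_dot mulr_suml mulr_sumr; apply: eq_bigr => i _; rewrite /ball_dot; ring.
Qed.

End BallProduct.

Section Wandering.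
Variables (R : realType) (n : nat) (H : hilbert R) (T : 'I_n -> H -> H) (x : H).
Hypothesis T_row : row_contraction T.

(* [q x] for the truncation [q] in degree [< N] of the kernel sum encoded by [s]. *)
Fixpoint wander N (s : seq (R[i] * unit_ball R n)) : H :=
  if N is N'.+1 then
    (\sum_(q <- s) q.1) *: x + \sum_(i < n) T i (wander N' (shift_coef i s))
  else 0.

Hypothesis x_wander : forall i N s, hdot H (T i (wander N s)) x = 0.

Lemma wander_le N s :
  hnorm (wander N s) ^+ 2 <= complex.Re (geo_sum N (gram s)) * hnorm x ^+ 2.
Proof.
elim: N s => [|N IH] s /=.
  rewrite hnorm0 expr0n /= /geo_sum big1_seq ?mul0r // => c _.
  by rewrite /geo big_ord0 mulr0.
rewrite hnorm_sqrD; last first.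
  rewrite hdotZl hdot_sumr [X in _ * X]big1 ?mulr0 // => i _.
  by rewrite hdotC x_wander rmorph0.
rewrite gram_sumS mulrDl hnormZ exprMn lerD2l.
rewrite (le_trans (row_contraction_sum _ T_row)) // mulr_suml.
by apply: ler_sum => i _; exact: IH.
Qed.

Lemma wander_dist_le N d s : hnorm (wander (N + d) s - wander N s) ^+ 2 <=
  (complex.Re (geo_sum (N + d) (gram s)) - complex.Re (geo_sum N (gram s))) * hnorm x ^+ 2.
Proof.
elim: N s => [|N IH] s.
  rewrite /= subr0 [in X in _ - X]/geo_sum big1_seq ?subr0; last first.
    by move=> c _; rewrite /geo big_ord0 mulr0.
  exact: wander_le.
rewrite addSn /= opprD addrACA subrr add0r -sumrB.
have TB i u v : T i u - T i v = T i (u - v).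
  have [T_bnd _ _] := T_row; have [T_lin _] := T_bnd i.
  by rewrite addrC -scaleN1r -T_lin scaleN1r addrC.
under eq_bigr do rewrite TB.
rewrite (le_trans (row_contraction_sum _ T_row)) // !gram_sumS.
rewrite opprD addrACA subrr add0r -sumrB mulr_suml.
by apply: ler_sum => i _; exact: IH.
Qed.

End Wandering.

Section Extension.
Variables (R : realType) (X : Type) (K L : X -> X -> R[i]) (H : rkhs K) (H' : rkhs L).
Variables (theta : X -> R[i]) (c : R).

Lemma multiplier_extend : 0 <= c ->
  (forall s, exists2 g : H',
    rkhs_fun g = (fun z => theta z * rkhs_fun (kernel_sum H s) z) &
    hnorm g <= c * hnorm (kernel_sum H s)) ->
  forall f : H, exists2 g : H',
    rkhs_fun g = (fun z => theta z * rkhs_fun f z) & hnorm g <= c * hnorm f.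
Proof.
move=> c_ge0 theta_ker f.
have [s s_lim] := choice (kernel_sum_dense f).
have [g gP] : {g : nat -> H' & forall m,
    rkhs_fun (g m) = (fun z => theta z * rkhs_fun (kernel_sum H (s m)) z) /\
    hnorm (g m) <= c * hnorm (kernel_sum H (s m))}.
  apply: (@choice _ _ (fun m h => rkhs_fun h =
      (fun z => theta z * rkhs_fun (kernel_sum H (s m)) z) /\
      hnorm h <= c * hnorm (kernel_sum H (s m)))) => m.
  by have [h hE h_le] := theta_ker (s m); exists h.
pose e m : R := m.+1%:R^-1.
have e0 : e @ \oo --> (0 : R) by exact: cvg_harmonic.
have e_anti m N : (m <= N)%N -> e N <= e m.
  by move=> mN; rewrite lef_pV2 ?posrE ?ler_nat.
have g_cauchy m N : (m <= N)%N -> hnorm (g N - g m) <= 4 * c * e m.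
  move=> mN; pose t := s N ++ [seq (- q.1, q.2) | q <- s m].
  have tE : kernel_sum H t = kernel_sum H (s N) - kernel_sum H (s m).
    rewrite /kernel_sum big_cat big_map /= -sumrN; congr (_ + _).
    by apply: eq_bigr => q _; rewrite scaleNr.
  have [h hE h_le] := theta_ker t.
  have -> : g N - g m = h.
    apply: rkhs_fun_inj; apply: funext => z.
    by rewrite hE tE !rkhs_funB (gP N).1 (gP m).1 mulrBr.
  rewrite (le_trans h_le) // tE.
  have -> : 4 * c * e m = c * (2 * e m + 2 * e m) by ring.
  rewrite ler_wpM2l //.
  have -> : kernel_sum H (s N) - kernel_sum H (s m) =
      (f - kernel_sum H (s m)) - (f - kernel_sum H (s N)).
    by rewrite opprB [RHS]addrC addrA subrK.
  rewrite (le_trans (hnormD _ _)) // hnormN lerD //.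
  by rewrite (le_trans (s_lim N)) // ler_wpM2l // e_anti.
have [l l_lim] := hilbert_cauchy (nullZ (4 * c) e0) g_cauchy.
exists l.
  apply: funext => z; apply/eqP; rewrite -subr_eq0; apply/eqP.
  apply: (eq0_of_null (nullZ (4 * c * hnorm (rkhs_ker H' z) +
    2 * normc (theta z) * hnorm (rkhs_ker H z)) e0)) => m.
  have -> : rkhs_fun l z - theta z * rkhs_fun f z =
      rkhs_fun (l - g m) z - theta z * rkhs_fun (f - kernel_sum H (s m)) z.
    rewrite !rkhs_funB (gP m).1; ring.
  rewrite (le_trans (normcB_le _ _)) // mulrDl lerD //.
    rewrite (le_trans (rkhs_fun_bound _ _)) // mulrAC.
    by rewrite ler_wpM2r ?hnorm_ge0.
  have -> : 2 * normc (theta z) * hnorm (rkhs_ker H z) * e m =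
      normc (theta z) * (2 * e m * hnorm (rkhs_ker H z)) by ring.
  rewrite normcM ler_wpM2l ?normc_ge0 // (le_trans (rkhs_fun_bound _ _)) //.
  by rewrite ler_wpM2r ?hnorm_ge0.
rewrite -subr_le0; apply: (le0_of_null (nullZ (6 * c) e0)) => m.
have lE : hnorm l <= hnorm (l - g m) + hnorm (g m).
  by rewrite -{1}[l](subrK (g m)) hnormD.
have sE : hnorm (kernel_sum H (s m)) <= hnorm f + 2 * e m.
  rewrite -[kernel_sum H (s m)](subKr f) (le_trans (hnormD _ _)) // hnormN lerD2l.
  exact: s_lim.
have := ler_wpM2l c_ge0 sE; have := (gP m).2; have := l_lim m; lra.
Qed.

End Extension.

Lemma mult_opE (R : realType) (Y : Type) (K1 K2 : Y -> Y -> R[i]) (H1 : rkhs K1) (H2 : rkhs K2)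
    (theta : Y -> R[i]) (f : H1) (g : H2) :
  rkhs_fun g = (fun z => theta z * rkhs_fun f z) -> mult_op H1 H2 theta f = g.
Proof.
move=> gE; rewrite /mult_op; case: xgetP => [h -> hE|/(_ g)//].
by apply: rkhs_fun_inj; rewrite hE gE.
Qed.

Section WanderingMultiplier.
Variables (R : realType) (n : nat) (K : unit_ball R n -> unit_ball R n -> R[i]).
Variables (H : rkhs K) (H2n : rkhs (@drury_arveson R n)) (x : H).
Hypothesis T_mult : forall i, multiplier H H (@coord_fun R n i).
Hypothesis T_row : row_contraction (Mz (H := H)).
Hypothesis x_wander : forall i N s, hdot H (Mz i (wander (Mz (H := H)) x N s)) x = 0.

Lemma rkhs_fun_Mz i (f : H) z : rkhs_fun (Mz i f) z = coord_fun i z * rkhs_fun f z.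
Proof. by have [g gE] := T_mult i f; rewrite /Mz (mult_opE gE) gE. Qed.

Lemma rkhs_fun_wander N s z : rkhs_fun (wander (Mz (H := H)) x N s) z =
  geo_sum N (eval_list s z) * rkhs_fun x z.
Proof.
elim: N s => [|N IH] s /=.
  rewrite rkhs_fun0 /geo_sum big1_seq ?mul0r // => c _.
  by rewrite /geo big_ord0 mulr0.
rewrite rkhs_funP rkhs_fun_sum eval_sumS mulrDl; congr (_ + _).
by rewrite mulr_suml; apply: eq_bigr => i _; rewrite rkhs_fun_Mz IH mulrA.
Qed.

Lemma wander_multiplier_ker s : exists2 g : H,
  rkhs_fun g = (fun z => rkhs_fun x z * rkhs_fun (kernel_sum H2n s) z) &
  hnorm g <= hnorm x * hnorm (kernel_sum H2n s).
Proof.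
pose V N := wander (Mz (H := H)) x N s; pose F := hnorm (kernel_sum H2n s).
pose err := geo_err (gram s); have err1 := gram_subunit s.
have errP N : normc ((F ^+ 2)%:C - geo_sum N (gram s)) <= err N.
  by rewrite -gram_lim; exact: geo_errP.
have Re_err N : `|F ^+ 2 - complex.Re (geo_sum N (gram s))| <= err N.
  apply: le_trans (errP N).
  rewrite -lecR -normcE_norm; apply: le_trans (normc_ge_Re _).
  by rewrite raddfB.
have err0 : err @ \oo --> (0 : R) by exact: geo_err_null.
have V_cauchy m N : (m <= N)%N ->
    hnorm (V N - V m) <= 2 * hnorm x * Num.sqrt (err m).
  move=> mN; rewrite -ler_sqr ?nnegrE ?hnorm_ge0 ?mulr_ge0 ?hnorm_ge0 ?sqrtr_ge0 //.
  rewrite !exprMn sqr_sqrtr ?geo_err_ge0 // -(subnKC mN).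
  rewrite (le_trans (wander_dist_le T_row x_wander _ _ _)) // subnKC //.
  rewrite mulrAC ler_wpM2r ?sqr_ge0 //.
  have := Re_err m; have := Re_err N; have := geo_err_anti err1 mN.
  rewrite !ler_norml -/err; have := geo_err_ge0 (gram s) m; rewrite -/err.
  by move=> ? ? /andP[? ?] /andP[? ?]; lra.
have s0 := null_sqrt err0.
have [g g_lim] := hilbert_cauchy (nullZ (2 * hnorm x) s0) V_cauchy.
exists g.
  apply: funext => z; apply/eqP; rewrite -subr_eq0; apply/eqP.
  have b0 : (fun m => hnorm (rkhs_ker H z) * (2 * hnorm x * Num.sqrt (err m)) +
      normc (rkhs_fun x z) * geo_err (eval_list s z) m) @ \oo --> (0 : R).
    have A := nullZ (hnorm (rkhs_ker H z)) (nullZ (2 * hnorm x) s0).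
    have B := nullZ (normc (rkhs_fun x z)) (geo_err_null (eval_list_subunit s z)).
    by have := cvgD A B; rewrite addr0; apply.
  apply: (eq0_of_null b0) => m.
  have -> : rkhs_fun g z - rkhs_fun x z * rkhs_fun (kernel_sum H2n s) z =
      rkhs_fun (g - V m) z -
      rkhs_fun x z * (geo_lim (eval_list s z) - geo_sum m (eval_list s z)).
    by rewrite rkhs_funB /V rkhs_fun_wander (eval_list_lim H2n); ring.
  rewrite (le_trans (normcB_le _ _)) // lerD //.
    by rewrite (le_trans (rkhs_fun_bound _ _)) // mulrC ler_wpM2l ?hnorm_ge0.
  by rewrite normcM ler_wpM2l ?normc_ge0 // geo_errP // eval_list_subunit.
rewrite -subr_le0; apply: (le0_of_null (nullZ (3 * hnorm x) s0)) => m.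
have gE : hnorm g <= hnorm (g - V m) + hnorm (V m).
  by rewrite -{1}[g](subrK (V m)) hnormD.
have VE : hnorm (V m) <= hnorm x * (F + Num.sqrt (err m)).
  rewrite -ler_sqr ?nnegrE ?mulr_ge0 ?addr_ge0 ?hnorm_ge0 ?sqrtr_ge0 //.
  rewrite (le_trans (wander_le T_row x_wander _ _)) // mulrC exprMn ler_wpM2l ?sqr_ge0 //.
  rewrite sqrrD sqr_sqrtr ?geo_err_ge0 //.
  have : 0 <= F * Num.sqrt (err m) by rewrite mulr_ge0 ?hnorm_ge0 ?sqrtr_ge0.
  have := Re_err m; rewrite ler_norml => /andP[? ?] ?; lra.
have := g_lim m; rewrite -/F; lra.
Qed.

Lemma wander_multiplier (f : H2n) : exists2 g : H,
  rkhs_fun g = (fun z => rkhs_fun x z * rkhs_fun f z) & hnorm g <= hnorm x * hnorm f.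
Proof.
by apply: multiplier_extend; [exact: hnorm_ge0 | exact: wander_multiplier_ker].
Qed.

Lemma wander_multiplier_norm : (hnorm x)%:E = multiplier_norm H2n H (rkhs_fun x).
Proof.
have zero_ball : \sum_(i < n) `|(0 : 'rV[R[i]]_n) 0 i| ^+ 2 < 1.
  by rewrite big1 ?ltr01 // => i _; rewrite mxE normr0 expr0n.
pose o : unit_ball R n := exist _ 0 zero_ball.
have o_dot z : ball_dot z o = 0.
  by rewrite /ball_dot big1 // => i _; rewrite /coord_fun /= mxE rmorph0 mulr0.
pose one := rkhs_ker H2n o.
have oneE z : rkhs_fun one z = 1.
  by rewrite rkhs_kerE /drury_arveson -/(ball_dot z o) o_dot subr0 invr1.
have one1 : hnorm one <= 1.
  rewrite -ler_sqr ?nnegrE ?hnorm_ge0 // expr1n hnorm_sqrE.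
  by rewrite -rkhs_reproducing oneE.
apply/eqP; rewrite eq_le; apply/andP; split; last first.
  apply: ub_ereal_sup => _ [u /= u1 <-]; rewrite lee_fin.
  have [g gE g_le] := wander_multiplier u.
  by rewrite (mult_opE gE) (le_trans g_le) // ler_piMr ?hnorm_ge0.
apply: ereal_sup_ubound; exists one => //; congr (_%:E); congr hnorm.
by apply: mult_opE; apply: funext => z; rewrite oneE mulr1.
Qed.

End WanderingMultiplier.

Section Weights.
Variables (R : realType) (n : nat) (K : unit_ball R n -> unit_ball R n -> R[i]).
Variables (H : rkhs K) (e : multinom n -> H) (wt : multinom n -> nat).
Hypothesis eE : forall k, rkhs_fun (e k) = monom_fun k.
Hypothesis e_orth : forall j k, j <> k -> hdot H (e j) (e k) = 0.

Definition weight_ge (d : nat) : set H :=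
  [set u | exists2 s : seq (R[i] * multinom n),
    all (fun q => d <= wt q.2)%N s & u = \sum_(q <- s) q.1 *: e q.2].

Lemma monom_funD (j k : multinom n) (z : unit_ball R n) :
  monom_fun (mnm_add j k) z = monom_fun j z * monom_fun k z.
Proof. by rewrite -big_split; apply: eq_bigr => i _; rewrite mnmDE exprD. Qed.

Lemma monom_fun1 i (z : unit_ball R n) : monom_fun (mnm1 i) z = coord_fun i z.
Proof.
rewrite /monom_fun (bigD1 i) //= big1 ?mulr1 => [|j ji].
  by rewrite mnm1E eqxx expr1.
by rewrite mnm1E eq_sym (negPf ji) expr0.
Qed.

Lemma weight_geD d u v : weight_ge d u -> weight_ge d v -> weight_ge d (u + v).
Proof.
move=> [s sd ->] [t td ->]; exists (s ++ t); first by rewrite all_cat sd.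
by rewrite big_cat.
Qed.

Lemma weight_geZ d (a : R[i]) u : weight_ge d u -> weight_ge d (a *: u).
Proof.
move=> [s sd ->]; exists [seq (a * q.1, q.2) | q <- s].
  by rewrite all_map; apply: sub_all sd.
by rewrite big_map scaler_sumr; apply: eq_bigr => q _; rewrite scalerA.
Qed.

Lemma weight_ge0 d : weight_ge d 0.
Proof. by exists [::]; rewrite ?big_nil. Qed.

Lemma weight_geW c d u : (c <= d)%N -> weight_ge d u -> weight_ge c u.
Proof.
by move=> cd [s sd ->]; exists s => //; apply: sub_all sd => q; exact: leq_trans.
Qed.

Lemma weight_ge_orth d u v : weight_ge d.+1 u ->
  (exists2 s : seq (R[i] * multinom n), all (fun q => wt q.2 == d) s &
    v = \sum_(q <- s) q.1 *: e q.2) -> hdot H u v = 0.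
Proof.
move=> [s /allP sd ->] [t /allP td ->]; rewrite hdot_suml big1_seq // => q /= /sd qd.
rewrite hdot_sumr big1_seq // => r /= /td /eqP rd.
rewrite hdotZl hdotZr e_orth ?mulr0 // => qr.
by move: qd; rewrite qr rd ltnn.
Qed.

Hypothesis wtD : forall j k, wt (mnm_add j k) = (wt j + wt k)%N.
Hypothesis T_mult : forall i, multiplier H H (@coord_fun R n i).

Lemma weight_ge_Mz d i u : (0 < wt (mnm1 i))%N ->
  weight_ge d u -> weight_ge d.+1 (Mz i u).
Proof.
move=> wi [s /allP sd ->]; exists [seq (q.1, mnm_add (mnm1 i) q.2) | q <- s].
  by apply/allP => _ /mapP[q /sd qd ->] /=; rewrite wtD -add1n leq_add.
apply: rkhs_fun_inj; apply: funext => z.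
rewrite (rkhs_fun_Mz T_mult) !rkhs_fun_sum big_map mulr_sumr; apply: eq_bigr => q _.
by rewrite !rkhs_funZ !eE monom_funD monom_fun1 mulrCA.
Qed.

Lemma weight_ge_wander d x N s : (forall i, 0 < wt (mnm1 i))%N ->
  weight_ge d x -> weight_ge d (wander (Mz (H := H)) x N s).
Proof.
move=> w1 xd; elim: N s => [|N IH] s /=; first exact: weight_ge0.
apply: weight_geD; first exact: weight_geZ.
elim/big_ind: _ => [|u v|i _]; [exact: weight_ge0|exact: weight_geD|].
by apply: (weight_geW (leqnSn d)); apply: weight_ge_Mz.
Qed.

End Weights.

Theorem corollary6p3 (R : realType) (n : nat)
    (K : unit_ball R n -> unit_ball R n -> R[i]) (HK : rkhs K)
    (H2n : rkhs (@drury_arveson R n)) (p : mpoly n R[i]) :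
  positive_definite K ->
  contractive_analytic HK ->
  monomial_orthogonal_basis HK ->
  quasi_homogeneous p ->
  exists f : HK,
    [/\ rkhs_fun f = poly_fun p,
        multiplier H2n HK (poly_fun p),
        (hnorm f)%:E = multiplier_norm H2n HK (poly_fun p)
      & hnorm f = 1 -> K_inner HK (poly_fun p)].
Proof.
move=> _ [_ T_mult T_row _] [e [eE [_ e_orth _]]] [m [l [m_gt0 p_wt]]].
pose wt (k : multinom n) := (\sum_(i < n) m i * k i)%N.
have wtD j k : wt (mnm_add j k) = (wt j + wt k)%N.
  by rewrite /wt -big_split; apply: eq_bigr => i _; rewrite mnmDE mulnDr.
have wt_gt0 k : k != mnm0 -> (0 < wt k)%N.
  rewrite lt0n; apply: contra; rewrite /wt sum_nat_eq0 => /forallP k0.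
  apply/eqP/mnmP => i; have := k0 i; rewrite /= muln_eq0 eqn0Ngt m_gt0 /= => /eqP ->.
  by rewrite mnm0E.
have wt1 i : (0 < wt (mnm1 i))%N.
  by apply: wt_gt0; apply/eqP => /mnmP/(_ i); rewrite mnm1E mnm0E eqxx.
pose x : HK := \sum_(k <- msupp p) mcoeff k p *: e k.
have p_wt' k : k \in msupp p -> wt k = l by rewrite mcoeff_msupp => /p_wt.
have xE : rkhs_fun x = poly_fun p.
  apply: funext => z; rewrite rkhs_fun_sum /poly_fun mevalE; apply: eq_bigr => k _.
  by rewrite rkhs_funZ eE.
have x_wt : exists2 s : seq (R[i] * multinom n), all (fun q => wt q.2 == l) s &
    x = \sum_(q <- s) q.1 *: e q.2.
  exists [seq (mcoeff k p, k) | k <- msupp p]; last by rewrite [RHS]big_map.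
  by apply/allP => _ /mapP[k /p_wt' kl ->]; rewrite /= kl.
have x_ge : weight_ge e wt l x.
  by have [s sl ->] := x_wt; exists s => //; apply: sub_all sl => q /eqP ->.
have x_wander i N s : hdot HK (Mz i (wander (Mz (H := HK)) x N s)) x = 0.
  apply: (weight_ge_orth e_orth _ x_wt); apply: (weight_ge_Mz eE wtD T_mult) => //.
  exact: (weight_ge_wander eE wtD T_mult).
exists x; split=> // [f||x1].
- have [g gE _] := wander_multiplier T_mult T_row x_wander f.
  by exists g; rewrite gE xE.
- by rewrite (wander_multiplier_norm H2n T_mult T_row x_wander) xE.
exists x; split=> // k k_neq0.
exists (\sum_(j <- msupp p) mcoeff j p *: e (mnm_add k j)); split.
  apply: funext => z; rewrite -xE !rkhs_fun_sum mulr_sumr; apply: eq_bigr => j _.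
  by rewrite !rkhs_funZ !eE monom_funD mulrCA.
rewrite hdotC (weight_ge_orth e_orth _ x_wt) ?rmorph0 //.
exists [seq (mcoeff j p, mnm_add k j) | j <- msupp p]; last by rewrite [RHS]big_map.
apply/allP => _ /mapP[j /p_wt' jl ->] /=; rewrite wtD jl.
by rewrite -[X in (X < _)%N]add0n ltn_add2r wt_gt0.
Qed.
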